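(* Let $\mathtt{A}$ be a complemented category with a generator $X$. Suppose that $\mathcal{C}$ is the skeleton of $\mathtt{A}$ spanned by the objects $X^n$ for all $n\in\mathbb{Z}_+$. Let $V$ be an $\mathtt{A}$-module over $R$, and regard $V$ also as a $\mathcal{C}$-module by restriction along the inclusion functor $\mathcal{C}\to\mathtt{A}$. Then $V$ is centrally stable in the sense of Putman and Sam if and only if $V$ is centrally stable as a $\mathcal{C}$-module over $R$.
   Context: $R$ is a commutative ring and $\mathbb{Z}_+$ is the set of non-negative integers. For a category $\mathtt{A}$, an $\mathtt{A}$-module over $R$ is a covariant functor from $\mathtt{A}$ to $R$-modules. A complemented category (Putman–Sam) is a symmetric monoidal category $(\mathtt{A},\circledast)$ such that: every morphism is a monomorphism; the unit object is initial (so there are canonical maps $U\to U\circledast U'$ and $U'\to U\circledast U'$); for all $U,U',W$ the map $\operatorname{Hom}(U\circledast U',W)\to\operatorname{Hom}(U,W)\times\operatorname{Hom}(U',W)$ given by composing with the canonical maps is injective; and every subobject $C$ of an object $U$ has a unique complement, i.e. a unique subobject $D$ of $U$ for which there is an isomorphism $C\circledast D\to U$ whose compositions with the canonical maps from $C$ and $D$ are the inclusions. A generator is an object $X$ such that every object is isomorphic to $X^n$ ($n$-fold monoidal power) for a unique $n\in\mathbb{Z}_+$. A consequence of the axioms is that the full subcategory $\mathcal{C}$ on the objects $X^n$, $n\in\mathbb{Z}_+$, is a skeleton of $\mathtt{A}$ with $\operatorname{Hom}_{\mathcal{C}}(X^m,X^n)=\emptyset$ if $m>n$; identify $\operatorname{Ob}(\mathcal{C})$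 with $\mathbb{Z}_+$ via $X^n\leftrightarrow n$. An $\mathtt{A}$-module $V$ over $R$ is centrally stable in the sense of Putman and Sam if for all sufficiently large $N$ the functor $V$ is the left Kan extension (along the inclusion) of the restriction of $V$ to the full subcategory of $\mathtt{A}$ spanned by the objects isomorphic to $X^n$ for some $n\leqslant N$. A $\mathcal{C}$-module $V$ over $R$ is centrally stable if, for all sufficiently large $N$, $Ae\otimes_{eAe}eW\cong W$ as $A$-modules, where: $A=\bigoplus_{m,n\in\mathbb{Z}_+}R\operatorname{Hom}_{\mathcal{C}}(m,n)$ is the category algebra (free $R$-module on the morphisms of $\mathcal{C}$, product given by composition, zero when not composable); $e=e_0+e_1+\cdots+e_N$ with $e_n$ the identity morphism of $n$; and $W=\bigoplus_{n\in\mathbb{Z}_+}V(n)$ with its natural $A$-module structure. *)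

(* Defs.v *)
From HB Require Import structures.
From mathcomp Require Import all_boot all_algebra generic_quotient ring_quotient.
From mathcomp Require Import boolp classical_sets cardinality fsbigop.

Set Implicit Arguments.
Unset Strict Implicit.
Unset Printing Implicit Defensive.

Import GRing.Theory.
Local Open Scope ring_scope.
Local Open Scope quotient_scope.

#[local] Obligation Tactic := idtac.

(* The type of objects is a parameter, so that a category can have exactly nat
   as its objects. *)

Record category (O : Type) := Category {
  hom :> O -> O -> Type;
  idm : forall U, hom U U;
  compm : forall U V W, hom V W -> hom U V -> hom U W;
  comp1m : forall U V (f : hom U V), compm (idm V) f = f;
  compm1 : forall U V (f : hom U V), compm f (idm U) = f;
  compmA : forall U V W Z (h : hom W Z) (g : hom V W) (f : hom U V),
    compm h (compm g f) = compm (compm h g) f }.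

Arguments idm {O c} U.
Arguments compm {O c U V W} g f.

Notation "g \om f" := (compm g f) (at level 40, left associativity).

Section Morphisms.
Variables (O : Type) (A : category O).

Definition mono U V (i : A U V) :=
  forall W (f g : A W U), i \om f = i \om g -> f = g.

Record iso U V := Iso {
  fwd :> A U V;
  bwd : A V U;
  fwdK : bwd \om fwd = idm U;
  bwdK : fwd \om bwd = idm V }.

Definition isomorphic U V := inhabited (iso U V).

(* A subobject of U is a monomorphism into U up to this relation. *)
Definition same_subobject U C D (i : A C U) (j : A D U) :=
  exists k : iso C D, j \om k = i.

End Morphisms.

Arguments fwd {O A U V} _.
Arguments bwd {O A U V} _.

Record functor O O' (A : category O) (B : category O') := Functor {
  fobj :> O -> O';
  fmap : forall U V, A U V -> B (fobj U) (fobj V);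
  fmap1 : forall U, fmap (idm U) = idm (fobj U);
  fmapM : forall U V W (g : A V W) (f : A U V),
    fmap (g \om f) = fmap g \om fmap f }.

Arguments fmap {O O' A B} F {U V} f : rename.

Record nattrans O O' (A : category O) (B : category O') (F G : functor A B) :=
  Nattrans {
  ntc :> forall U, B (F U) (G U);
  ntcN : forall U V (f : A U V), ntc V \om fmap F f = fmap G f \om ntc U }.

Section FunctorComposition.
Variables (O O' O'' : Type).
Variables (A : category O) (B : category O') (C : category O'').

Program Definition functor_comp (G : functor B C) (F : functor A B) :
    functor A C :=
  @Functor _ _ A C (fun U => G (F U)) (fun U V f => fmap G (fmap F f)) _ _.
Next Obligation. by move=> G F U /=; rewrite !fmap1. Qed.
Next Obligation. by move=> G F U V W g f /=; rewrite !fmapM. Qed.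

End FunctorComposition.

Program Definition nattrans_id O O' (A : category O) (B : category O')
    (F : functor A B) : nattrans F F :=
  @Nattrans _ _ A B F F (fun U => idm (F U)) _.
Next Obligation. by move=> * /=; rewrite comp1m compm1. Qed.

(* The full subcategory of A on the objects s i, with i itself as the name of
   the object s i.  For s = val it is the full subcategory on a predicate. *)
Section FullSubcategory.
Variables (O I : Type) (A : category O) (s : I -> O).

Program Definition full_on : category I :=
  @Category I (fun i j => A (s i) (s j)) (fun i => idm (s i))
    (fun _ _ _ g f => g \om f) _ _ _.
Next Obligation. by move=> * /=; rewrite comp1m. Qed.
Next Obligation. by move=> * /=; rewrite compm1. Qed.
Next Obligation. by move=> * /=; rewrite compmA. Qed.

Program Definition full_incl : functor full_on A :=
  @Functor _ _ full_on A s (fun _ _ f => f) _ _.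
Next Obligation. by []. Qed.
Next Obligation. by []. Qed.

End FullSubcategory.

Definition is_left_kan O O' O'' (C : category O) (D : category O')
    (E : category O'') (K : functor C D) (F : functor C E) (L : functor D E)
    (eta : nattrans F (functor_comp L K)) :=
  forall (M : functor D E) (gamma : nattrans F (functor_comp M K)),
  exists! delta : nattrans L M,
    forall c, gamma c = delta (K c) \om eta c.

Record sym_monoidal O (A : category O) := SymMonoidal {
  tens : O -> O -> O;
  tensm : forall U U' W W', A U U' -> A W W' -> A (tens U W) (tens U' W');
  munit : O;
  assoc : forall U V W, iso A (tens (tens U V) W) (tens U (tens V W));
  lunit : forall U, iso A (tens munit U) U;
  runit : forall U, iso A (tens U munit) U;
  braid : forall U V, iso A (tens U V) (tens V U);
  tensm1 : forall U W, tensm (idm U) (idm W) = idm (tens U W);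
  tensmM : forall U U' U'' W W' W''
    (g : A U' U'') (f : A U U') (g' : A W' W'') (f' : A W W'),
    tensm (g \om f) (g' \om f') = tensm g g' \om tensm f f';
  assocN : forall U U' V V' W W' (f : A U U') (g : A V V') (h : A W W'),
    assoc U' V' W' \om tensm (tensm f g) h
    = tensm f (tensm g h) \om assoc U V W;
  lunitN : forall U U' (f : A U U'),
    lunit U' \om tensm (idm munit) f = f \om lunit U;
  runitN : forall U U' (f : A U U'),
    runit U' \om tensm f (idm munit) = f \om runit U;
  braidN : forall U U' V V' (f : A U U') (g : A V V'),
    braid U' V' \om tensm f g = tensm g f \om braid U V;
  pentagon : forall U V W Z,
    assoc U V (tens W Z) \om assoc (tens U V) W Z
    = tensm (idm U) (assoc V W Z) \om assoc U (tens V W) Z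
      \om tensm (assoc U V W) (idm Z);
  triangle : forall U V,
    tensm (idm U) (lunit V) \om assoc U munit V = tensm (runit U) (idm V);
  hexagon : forall U V W,
    assoc V W U \om braid U (tens V W) \om assoc U V W
    = tensm (idm V) (braid U W) \om assoc V U W
      \om tensm (braid U V) (idm W);
  braidK : forall U V, braid V U \om braid U V = idm (tens U V) }.

Section Complemented.
Variables (O : Type) (A : category O) (M : sym_monoidal A).

(* The canonical maps U -> U * U' and U' -> U * U', given the maps from the
   unit object to U' and to U. *)
Definition canl U U' (z : A (munit M) U') : A U (tens M U U') :=
  tensm M (idm U) z \om bwd (runit M U).
Definition canr U U' (z : A (munit M) U) : A U' (tens M U U') :=
  tensm M z (idm U') \om bwd (lunit M U').

Definition is_complement (zero : forall U, A (munit M) U)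
    U C D (i : A C U) (j : A D U) :=
  exists phi : iso A (tens M C D) U,
    phi \om canl C (zero D) = i /\ phi \om canr D (zero C) = j.

Record complemented := Complemented {
  all_mono : forall U V (f : A U V), mono f;
  zero : forall U, A (munit M) U;
  zero_uniq : forall U (f : A (munit M) U), f = zero U;
  hom_tens_inj : forall U U' W (f g : A (tens M U U') W),
    f \om canl U (zero U') = g \om canl U (zero U') ->
    f \om canr U' (zero U) = g \om canr U' (zero U) -> f = g;
  complement_exists : forall U C (i : A C U), mono i ->
    exists D (j : A D U), mono j /\ is_complement zero i j;
  complement_unique : forall U C (i : A C U), mono i ->
    forall D (j : A D U) D' (j' : A D' U),
    mono j -> is_complement zero i j ->
    mono j' -> is_complement zero i j' -> same_subobject j j' }.

Fixpoint mpow (X : O) n : O :=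
  if n is n'.+1 then tens M (mpow X n') X else munit M.

Definition generator (X : O) :=
  forall U, exists! n, isomorphic A U (mpow X n).

(* The object X^n is called n. *)
Definition skeleton (X : O) : category nat := full_on A (mpow X).
Definition skeleton_incl (X : O) : functor (skeleton X) A :=
  full_incl A (mpow X).

End Complemented.

Section RModules.
Variable R : pzRingType.

Lemma linear_ext (U V : lmodType R) (f g : {linear U -> V}) :
  (forall u, f u = g u) -> f = g.
Proof.
case: f g => [f [[mf] [sf]]] [g [[mg] [sg]]] /= fg.
have {}fg := funext fg; subst g.
by rewrite (Prop_irrelevance mf mg) (Prop_irrelevance sf sg).
Qed.

Program Definition RMod : category (lmodType R) :=
  @Category (lmodType R) (fun U V => {linear U -> V})
    (fun U => idfun : {linear U -> U}) (fun U V W g f => g \o f : {linear U -> W})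
    _ _ _.
Next Obligation. by move=> *; apply: linear_ext. Qed.
Next Obligation. by move=> *; apply: linear_ext. Qed.
Next Obligation. by move=> *; apply: linear_ext. Qed.

End RModules.

Section DirectSum.
Variables (R : pzRingType) (I : choiceType) (V : I -> lmodType R).

Record dsum := Dsum {
  dfun :> forall i, V i;
  dfun_fin : finite_set [set i | dfun i != 0] }.

HB.instance Definition _ := gen_eqMixin dsum.
HB.instance Definition _ := gen_choiceMixin dsum.

Lemma dsumP (x y : dsum) : (forall i, x i = y i) -> x = y.
Proof.
case: x y => [x fx] [y fy] /= xy.
have {}xy := functional_extensionality_dep xy; subst y.
by rewrite (Prop_irrelevance fx fy).
Qed.

Fact dsum_lin_fin (a : R) (x y : dsum) :
  finite_set [set i | a *: x i + y i != 0].
Proof.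
apply: (@sub_finite_set _ _ ([set i | x i != 0] `|` [set i | y i != 0])%classic).
  move=> i /=; have [->|] := eqVneq (x i) 0; last by left.
  by rewrite scaler0 add0r; right.
by rewrite finite_setU; split; apply: dfun_fin.
Qed.

Fact dsum0_fin : finite_set [set i | (0 : V i) != 0].
Proof. by apply: (@sub_finite_set _ _ set0) => // i /=; rewrite eqxx. Qed.

Fact dsumD_fin (x y : dsum) : finite_set [set i | x i + y i != 0].
Proof.
by apply: sub_finite_set (dsum_lin_fin 1 x y) => i /=; rewrite scale1r.
Qed.

Fact dsumZ_fin (a : R) (x : dsum) : finite_set [set i | a *: x i != 0].
Proof.
apply: sub_finite_set (dfun_fin x) => i /=.
by apply: contra_neq => ->; rewrite scaler0.
Qed.

Fact dsumN_fin (x : dsum) : finite_set [set i | - x i != 0].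
Proof. by apply: sub_finite_set (dfun_fin x) => i /=; rewrite oppr_eq0. Qed.

Fact dsum_addA : associative (fun x y => Dsum (dsumD_fin x y)).
Proof. by move=> x y z; apply: dsumP => i /=; rewrite addrA. Qed.
Fact dsum_addC : commutative (fun x y => Dsum (dsumD_fin x y)).
Proof. by move=> x y; apply: dsumP => i /=; rewrite addrC. Qed.
Fact dsum_add0 : left_id (Dsum dsum0_fin) (fun x y => Dsum (dsumD_fin x y)).
Proof. by move=> x; apply: dsumP => i /=; rewrite add0r. Qed.
Fact dsum_addN : left_inverse (Dsum dsum0_fin) (fun x => Dsum (dsumN_fin x))
  (fun x y => Dsum (dsumD_fin x y)).
Proof. by move=> x; apply: dsumP => i /=; rewrite addNr. Qed.

HB.instance Definition _ :=
  GRing.isZmodule.Build dsum dsum_addA dsum_addC dsum_add0 dsum_addN.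

Let scale a x := Dsum (dsumZ_fin a x).
Fact dsum_scaleA a b x : scale a (scale b x) = scale (a * b) x.
Proof. by apply: dsumP => i /=; rewrite scalerA. Qed.
Fact dsum_scale1 : left_id 1 scale.
Proof. by move=> x; apply: dsumP => i /=; rewrite scale1r. Qed.
Fact dsum_scaleDr : right_distributive scale +%R.
Proof. by move=> a x y; apply: dsumP => i /=; rewrite scalerDr. Qed.
Fact dsum_scaleDl x : {morph scale^~ x : a b / a + b}.
Proof. by move=> a b; apply: dsumP => i /=; rewrite scalerDl. Qed.

HB.instance Definition _ := GRing.Zmodule_isLmodule.Build R dsum
  dsum_scaleA dsum_scale1 dsum_scaleDr dsum_scaleDl.

Lemma dsumDE (x y : dsum) i : (x + y) i = x i + y i. Proof. by []. Qed.
Lemma dsumZE a (x : dsum) i : (a *: x) i = a *: x i. Proof. by []. Qed.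
Lemma dsum0E i : (0 : dsum) i = 0. Proof. by []. Qed.

Definition dinj_fun i (v : V i) j : V j :=
  if i =P j is ReflectT e then ecast k (V k) e v else 0.

Fact dinj_fin i (v : V i) : finite_set [set j | dinj_fun v j != 0].
Proof.
apply: (@sub_finite_set _ _ [set i]%classic) => // j /=; rewrite /dinj_fun.
by case: eqP => [e _|_]; [exact: esym e | rewrite eqxx].
Qed.

Definition dinj i (v : V i) : dsum := Dsum (dinj_fin v).

Lemma dinj_id i (v : V i) : dinj v i = v.
Proof.
by rewrite /= /dinj_fun; case: eqP => // e; rewrite (Prop_irrelevance e erefl).
Qed.

Lemma dinj_neq i (v : V i) j : i != j -> dinj v j = 0.
Proof. by rewrite /= /dinj_fun; case: eqP. Qed.

Fact dinj_linear i : linear (@dinj i).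
Proof.
move=> a v w; apply: dsumP => j; rewrite dsumDE dsumZE.
have [<-|ij] := eqVneq i j; first by rewrite !dinj_id.
by rewrite !dinj_neq // scaler0 addr0.
Qed.

HB.instance Definition _ i :=
  GRing.isLinear.Build R (V i) dsum *:%R (@dinj i) (@dinj_linear i).

Lemma dsum_expand (s : seq I) (x : dsum) : uniq s ->
  (forall i, i \notin s -> x i = 0) -> x = \sum_(i <- s) dinj (x i).
Proof.
move=> us xs; apply: dsumP => j.
have -> : (\sum_(i <- s) dinj (x i)) j = \sum_(i <- s) dinj (x i) j.
  by elim: (s) => [|i t IH]; rewrite ?big_nil // !big_cons dsumDE IH.
have [js|/[dup] js /xs ->] := boolP (j \in s); last first.
  rewrite big1_seq // => i /andP[_ iS].
  by rewrite dinj_neq //; apply: contraNneq js => <-.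
rewrite (bigD1_seq j) // dinj_id big1 => [|i ij]; last exact: dinj_neq.
by rewrite [RHS]addr0.
Qed.

Lemma dsum_supp (x : dsum) : {s : seq I | uniq s &
  forall i, i \notin s -> x i = 0}.
Proof.
have /cid[s xs] : exists s : seq I, forall i, i \notin s -> x i = 0.
  case/finite_seqP: (dfun_fin x) => s sE; exists s => i.
  apply: contraNeq => xi; have : [set i | x i != 0]%classic i by [].
  by rewrite sE.
exists (undup s); first exact: undup_uniq.
by move=> i; rewrite mem_undup; apply: xs.
Qed.

End DirectSum.

Section FreeModule.
Variables (R : pzRingType) (I : choiceType).

Definition freemod := dsum (fun _ : I => R^o).

Definition basis (i : I) : freemod := dinj (i := i) (1 : R^o).

Section LinearExtension.
Variables (M : lmodType R) (f : I -> M).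

(* The linear extension of f. *)
Definition lext (x : freemod) : M := \sum_(i \in [set: I]) (x i : R) *: f i.

Lemma lextE (s : seq I) (x : freemod) : uniq s ->
  (forall i, i \notin s -> x i = 0) -> lext x = \sum_(i <- s) (x i : R) *: f i.
Proof.
move=> us xs; rewrite /lext [RHS]fsbig_seq //; symmetry.
apply: fsbig_widen => // i [_ /= /negP/xs ->].
by rewrite scale0r.
Qed.

Fact lext_linear : linear lext.
Proof.
move=> a x y; have [s us xs] := dsum_supp x; have [t ut yt] := dsum_supp y.
pose r := undup (s ++ t); have ur : uniq r by apply: undup_uniq.
have xr i : i \notin r -> x i = 0.
  by rewrite mem_undup mem_cat negb_or => /andP[/xs].
have yr i : i \notin r -> y i = 0.
  by rewrite mem_undup mem_cat negb_or => /andP[_ /yt].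
rewrite !(@lextE r) //; last first.
  by move=> i ir; rewrite dsumDE dsumZE xr // yr // scaler0 addr0.
rewrite scaler_sumr -big_split; apply: eq_bigr => i _ /=.
by rewrite scalerDl scalerA.
Qed.

HB.instance Definition _ :=
  GRing.isLinear.Build R freemod M *:%R lext lext_linear.

Lemma lext_basis i : lext (basis i) = f i.
Proof.
rewrite (@lextE [:: i]) ?big_seq1 ?dinj_id ?scale1r // => j.
by rewrite inE eq_sym => ij; rewrite dinj_neq.
Qed.

End LinearExtension.

Lemma freemod_ind (M : lmodType R) (f g : {linear freemod -> M}) :
  (forall i, f (basis i) = g (basis i)) -> f =1 g.
Proof.
move=> fg x; have [s us xs] := dsum_supp x.
have -> : x = \sum_(i <- s) (x i : R) *: basis i.
  rewrite {1}(dsum_expand us xs); apply: eq_bigr => i _.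
  by rewrite -linearZ /= /GRing.scale /= mulr1.
by rewrite !linear_sum; apply: eq_bigr => i _; rewrite !linearZ /= fg.
Qed.

End FreeModule.

Arguments basis {R I} i.

Section Image.
Variables (R : pzRingType) (U V : lmodType R) (f : {linear U -> V}).

Definition in_image : pred V := fun v => `[< exists u, f u = v >].

Fact in_image_closed : submod_closed in_image.
Proof.
split=> [|a _ _ /asboolP[u <-] /asboolP[v <-]]; apply/asboolP.
  by exists 0; rewrite linear0.
by exists (a *: u + v); rewrite linearP.
Qed.

HB.instance Definition _ :=
  GRing.isSubmodClosed.Build R V in_image
    (GRing.submod_closed_semi in_image_closed).

Record lin_image := Image { image_val : V; _ : image_val \in in_image }.

HB.instance Definition _ := [isSub for image_val].
HB.instance Definition _ := [Choice of lin_image by <:].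
HB.instance Definition _ := [SubChoice_isSubLmodule of lin_image by <:].

End Image.

Arguments Image {R U V f} image_val _.

Lemma imageP (R : pzRingType) (U V : lmodType R) (f : {linear U -> V})
  (v : lin_image f) : exists u, f u = val v.
Proof. by apply/asboolP; exact: valP v. Qed.

(* The quotient of F by the submodule that P generates. *)
Section LinearQuotient.
Variables (R : pzRingType) (F : lmodType R) (P : set F).

Definition in_span : pred F := fun x => `[< forall S : set F, S 0 ->
  (forall a u v, S u -> S v -> S (a *: u + v)) -> (P `<=` S)%classic -> S x >].

Fact in_span_closed : submod_closed in_span.
Proof.
split=> [|a u v /asboolP Pu /asboolP Pv]; first by apply/asboolP => S.
by apply/asboolP => S S0 SP PS; apply: (SP); [apply: Pu|apply: Pv].
Qed.

HB.instance Definition _ :=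
  GRing.isSubmodClosed.Build R F in_span
    (GRing.submod_closed_semi in_span_closed).

Definition modspan := Quotient.quot (GRing.ZmodClosed.clone F in_span _).

HB.instance Definition _ := EqQuotient.on modspan.
HB.instance Definition _ := GRing.Zmodule.on modspan.

Lemma pi_modspanE (x y : F) :
  (\pi_modspan x == \pi_modspan y) = (x - y \in in_span).
Proof. by rewrite -Quotient.idealrBE. Qed.

Lemma pi_modspan_add (x y : F) :
  \pi_modspan (x + y) = \pi_modspan x + \pi_modspan y.
Proof. exact: Quotient.pi_add. Qed.

Let qscale (a : R) (x : modspan) : modspan := \pi_modspan (a *: repr x).

Let pi_qscale a (x : F) : qscale a (\pi_modspan x) = \pi_modspan (a *: x).
Proof.
apply/eqP; rewrite pi_modspanE -scalerBr; apply: rpredZ.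
by rewrite -pi_modspanE reprK.
Qed.

Lemma pi_modspan_ind (T : modspan -> Prop) :
  (forall x, T (\pi_modspan x)) -> forall y, T y.
Proof. by move=> Tpi y; rewrite -[y]reprK; apply: Tpi. Qed.

Fact modspan_scaleA a b x : qscale a (qscale b x) = qscale (a * b) x.
Proof. by elim/pi_modspan_ind: x => x; rewrite !pi_qscale scalerA. Qed.
Fact modspan_scale1 : left_id 1 qscale.
Proof. by elim/pi_modspan_ind => x; rewrite pi_qscale scale1r. Qed.
Fact modspan_scaleDr : right_distributive qscale +%R.
Proof.
move=> a; elim/pi_modspan_ind => x; elim/pi_modspan_ind => y.
by rewrite -pi_modspan_add !pi_qscale scalerDr pi_modspan_add.
Qed.
Fact modspan_scaleDl x : {morph qscale^~ x : a b / a + b}.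
Proof.
elim/pi_modspan_ind: x => x a b.
by rewrite !pi_qscale scalerDl pi_modspan_add.
Qed.

HB.instance Definition _ := GRing.Zmodule_isLmodule.Build R modspan
  modspan_scaleA modspan_scale1 modspan_scaleDr modspan_scaleDl.

Definition modpi (x : F) : modspan := \pi_modspan x.

Fact modpi_linear : linear modpi.
Proof. by move=> a x y; rewrite /modpi pi_modspan_add -pi_qscale. Qed.

HB.instance Definition _ :=
  GRing.isLinear.Build R F modspan *:%R modpi modpi_linear.

Lemma modpi_ind (T : modspan -> Prop) :
  (forall x, T (modpi x)) -> forall y, T y.
Proof. exact: pi_modspan_ind. Qed.

Lemma modpi_rel (x : F) : P x -> modpi x = 0.
Proof.
move=> Px; rewrite -(linear0 modpi); apply/eqP; rewrite pi_modspanE subr0.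
by apply/asboolP => S _ _; apply.
Qed.

Section Lift.
Variables (N : lmodType R) (f : {linear F -> N}).

Definition qlift (x : modspan) : N := f (repr x).

Hypothesis f_rel : forall x, P x -> f x = 0.

Lemma qlift_pi x : qlift (modpi x) = f x.
Proof.
apply/eqP; rewrite -subr_eq0 -linearB; apply/eqP.
have : repr (modpi x) - x \in in_span by rewrite -pi_modspanE reprK.
move=> /asboolP/(_ [set y | f y = 0]%classic); apply; first exact: linear0.
  by move=> a u v /= fu fv; rewrite linearP fu fv scaler0 addr0.
exact: f_rel.
Qed.

Lemma qlift_linear : linear qlift.
Proof.
move=> a; elim/modpi_ind => x; elim/modpi_ind => y.
by rewrite -linearP !qlift_pi linearP.
Qed.

End Lift.

End LinearQuotient.

(* The tensor product over B of a right B-module M and a left B-module P, for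
   an R-algebra B.  The ring structure of B plays no role in it. *)
Section Tensor.
Variables (R : comPzRingType) (B : Type) (M P : lmodType R).
Variables (ract : M -> B -> M) (lact : B -> P -> P).

Definition elem (m : M) (p : P) : freemod R (M * P)%type := basis (m, p).

Inductive tensor_rel : set (freemod R (M * P)%type) :=
| tensor_addl m m' p : tensor_rel (elem (m + m') p - (elem m p + elem m' p))
| tensor_addr m p p' : tensor_rel (elem m (p + p') - (elem m p + elem m p'))
| tensor_scalel a m p : tensor_rel (elem (a *: m) p - a *: elem m p)
| tensor_scaler a m p : tensor_rel (elem m (a *: p) - a *: elem m p)
| tensor_bal m b p : tensor_rel (elem (ract m b) p - elem m (lact b p)).

Definition tensor := modspan tensor_rel.

Definition tmk (m : M) (p : P) : tensor := modpi tensor_rel (elem m p).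

Record balanced (N : lmodType R) (f : M -> P -> N) : Prop := Balanced {
  balanced_l : forall p, linear (f^~ p);
  balanced_r : forall m, linear (f m);
  balanced_b : forall m b p, f (ract m b) p = f m (lact b p) }.

Fact tmk_balanced : balanced tmk.
Proof.
have rel x y : tensor_rel (x - y) -> modpi tensor_rel x = modpi tensor_rel y.
  by move=> /modpi_rel; rewrite linearB => /eqP; rewrite subr_eq0 => /eqP.
have addl m m' p : tmk (m + m') p = tmk m p + tmk m' p.
  by rewrite -[RHS]linearD; exact: rel (tensor_addl _ _ _).
have addr m p p' : tmk m (p + p') = tmk m p + tmk m p'.
  by rewrite -[RHS]linearD; exact: rel (tensor_addr _ _ _).
have scalel a m p : tmk (a *: m) p = a *: tmk m p.
  by rewrite -[RHS]linearZ; exact: rel (tensor_scalel _ _ _).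
have scaler a m p : tmk m (a *: p) = a *: tmk m p.
  by rewrite -[RHS]linearZ; exact: rel (tensor_scaler _ _ _).
split=> [p a m m'|m a p p'|m b p]; last exact: rel (tensor_bal _ _ _).
  by rewrite /= addl scalel.
by rewrite addr scaler.
Qed.

(* The linear map that a balanced map f induces; see tlift_tmk. *)
Definition tlift (N : lmodType R) (f : M -> P -> N) : tensor -> N :=
  @qlift _ _ tensor_rel N (lext (fun mp => f mp.1 mp.2)).

Section Lift.
Variables (N : lmodType R) (f : M -> P -> N).
Hypothesis bf : balanced f.

Fact tlift_rel x : tensor_rel x -> lext (fun mp => f mp.1 mp.2) x = 0.
Proof.
have fl a m m' p : f (a *: m + m') p = a *: f m p + f m' p.
  exact: balanced_l.
have fr a m p p' : f m (a *: p + p') = a *: f m p + f m p'.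
  exact: balanced_r.
have f0l p : f 0 p = 0.
  by have := fl (-1) 0 0 p; rewrite scaler0 addr0 scaleN1r addNr.
have f0r m : f m 0 = 0.
  by have := fr (-1) m 0 0; rewrite scaler0 addr0 scaleN1r addNr.
have fDl m m' p : f (m + m') p = f m p + f m' p.
  by have := fl 1 m m' p; rewrite !scale1r.
have fDr m p p' : f m (p + p') = f m p + f m p'.
  by have := fr 1 m p p'; rewrite !scale1r.
have fZl a m p : f (a *: m) p = a *: f m p.
  by have := fl a m 0 p; rewrite f0l !addr0.
have fZr a m p : f m (a *: p) = a *: f m p.
  by have := fr a m p 0; rewrite f0r !addr0.
case=> [m m' p|m p p'|a m p|a m p|m b p].
- by rewrite linearB linearD /elem /= !lext_basis /= fDl subrr.
- by rewrite linearB linearD /elem /= !lext_basis /= fDr subrr.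
- by rewrite linearB linearZ /elem /= !lext_basis /= fZl subrr.
- by rewrite linearB linearZ /elem /= !lext_basis /= fZr subrr.
- by rewrite linearB /elem /= !lext_basis /= (balanced_b bf) subrr.
Qed.

Lemma tlift_linear : linear (tlift f).
Proof. exact: qlift_linear tlift_rel. Qed.

Lemma tlift_tmk m p : tlift f (tmk m p) = f m p.
Proof. by rewrite /tlift (qlift_pi tlift_rel) /= /elem lext_basis. Qed.

End Lift.

Lemma tensor_ind (N : lmodType R) (f g : {linear tensor -> N}) :
  (forall m p, f (tmk m p) = g (tmk m p)) -> f =1 g.
Proof.
move=> fg; elim/modpi_ind => x.
pose f' := f \o modpi tensor_rel; pose g' := g \o modpi tensor_rel.
by apply: (@freemod_ind _ _ _ f' g') => -[m p]; apply: fg.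
Qed.

End Tensor.

Section CategoryAlgebra.
Variables (R : comPzRingType) (O : choiceType) (C : category O).

Record mor := Mor { src : O; tgt : O; arr : C src tgt }.

HB.instance Definition _ := gen_eqMixin mor.
HB.instance Definition _ := gen_choiceMixin mor.

Definition catalg := freemod R mor.

Definition bmul (g f : mor) : catalg :=
  if tgt f =P src g is ReflectT e then
    basis (Mor (arr g \om ecast U (C (src f) U) e (arr f)))
  else 0.

Definition camul (a b : catalg) : catalg :=
  lext (fun g => lext (fun f => bmul g f) b) a.

Fact camul_linear_l b : linear (camul^~ b).
Proof. by move=> c x y; exact: linearP. Qed.

Fact lext_fun_linear (I : choiceType) (M N : lmodType R) (f : I -> M -> N)
    (a : freemod R I) :
  (forall i, linear (f i)) -> linear (fun x => lext (fun i => f i x) a).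
Proof.
move=> fl c x y; have [s us sa] := dsum_supp a.
rewrite !(lextE _ us sa) scaler_sumr -big_split; apply: eq_bigr => i _.
by rewrite fl scalerDr !scalerA mulrC.
Qed.

Fact camul_linear_r a : linear (camul a).
Proof. by apply: lext_fun_linear => g c x y; exact: linearP. Qed.

HB.instance Definition _ a := GRing.isLinear.Build R catalg catalg *:%R
  (camul a) (@camul_linear_r a).

Definition rcamul b : catalg -> catalg := camul^~ b.

HB.instance Definition _ b := GRing.isLinear.Build R catalg catalg *:%R
  (rcamul b) (@camul_linear_l b).

Lemma camul0l b : camul 0 b = 0.
Proof. exact: linear0 (rcamul b). Qed.

Lemma camul_basis g f : camul (basis g) (basis f) = bmul g f.
Proof. by rewrite /camul !lext_basis. Qed.

Lemma bmul_comp U V W (g : C V W) (f : C U V) :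
  bmul (Mor g) (Mor f) = basis (Mor (g \om f)).
Proof.
by rewrite /bmul; case: eqP => //= e; rewrite (Prop_irrelevance e erefl).
Qed.

Lemma bmul_neq g f : tgt f <> src g -> bmul g f = 0.
Proof. by rewrite /bmul; case: eqP. Qed.

Fact bmulA h g f : camul (basis h) (bmul g f) = camul (bmul h g) (basis f).
Proof.
case: h g f => [W Z h] [V' W' g] [U V f].
have [gf|gf] := pselect (V = V'); have [hg|hg] := pselect (W' = W).
- by subst V' W'; rewrite !bmul_comp !camul_basis !bmul_comp compmA.
- subst V'; rewrite bmul_comp camul_basis !bmul_neq //.
  by rewrite camul0l.
- subst W'; rewrite bmul_comp camul_basis !bmul_neq //.
  by rewrite linear0.
- by rewrite !bmul_neq // linear0 camul0l.
Qed.

Lemma camulA a b c : camul a (camul b c) = camul (camul a b) c.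
Proof.
have bbl g f : camul (basis g) (camul (basis f) c)
             = camul (camul (basis g) (basis f)) c.
  pose F := camul (basis g) \o camul (basis f).
  pose G := camul (camul (basis g) (basis f)).
  by apply: (@freemod_ind _ _ _ F G) => h; rewrite /F /G /= !camul_basis bmulA.
have bl g : camul (basis g) (camul b c) = camul (camul (basis g) b) c.
  pose F := camul (basis g) \o rcamul c.
  pose G := rcamul c \o camul (basis g).
  by apply: (@freemod_ind _ _ _ F G) => f; apply: bbl.
pose F := rcamul (camul b c); pose G := rcamul c \o rcamul b.
by apply: (@freemod_ind _ _ _ F G).
Qed.

(* There is no unit axiom, because the category algebra has no unit when the
   category has infinitely many objects. *)
Record camodule := CAModule {
  cacar :> lmodType R;
  caact : catalg -> cacar -> cacar;
  caact_l : forall x, linear (caact^~ x);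
  caact_r : forall a, linear (caact a);
  caactA : forall a b x, caact a (caact b x) = caact (camul a b) x }.

HB.instance Definition _ (W : camodule) a :=
  GRing.isLinear.Build R W W *:%R (@caact W a) (@caact_r W a).

Definition ca_isomorphic (W W' : camodule) :=
  exists phi : {linear W -> W'}, bijective phi /\
    forall a x, phi (caact a x) = caact a (phi x).

Section Total.
Variable V : functor C (RMod R).

Definition modmap U W (f : C U W) : {linear V U -> V W} := fmap V f.

(* A morphism g acts by V(g) on the summand of its source, and by 0 on the
   other summands. *)
Definition total_act (a : catalg) (w : dsum (fobj V)) : dsum (fobj V) :=
  lext (fun g => dinj (modmap (arr g) (w (src g)))) a.

Fact total_act_l w : linear (total_act^~ w).
Proof. by move=> c x y; exact: linearP. Qed.

Fact total_act_r a : linear (total_act a).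
Proof.
by apply: lext_fun_linear => g c x y; rewrite dsumDE dsumZE !linearP.
Qed.

Fact total_actA a b w :
  total_act a (total_act b w) = total_act (camul a b) w.
Proof.
have bb g f : total_act (basis g) (total_act (basis f) w)
            = total_act (bmul g f) w.
  rewrite /total_act !lext_basis.
  case: g f => [V' W g] [U V'' f].
  have [e|ne] := pselect (V'' = V').
    by subst V''; rewrite bmul_comp lext_basis dinj_id /modmap fmapM.
  by rewrite bmul_neq // dinj_neq ?linear0 //; apply/eqP.
pose L w : catalg -> _ := total_act^~ w.
pose LL w := GRing.isLinear.Build R _ _ *:%R (L w) (@total_act_l w).
pose Lw w : {linear catalg -> dsum (fobj V)} := HB.pack (L w) (LL w).
pose T a := total_act a.
pose TT a := GRing.isLinear.Build R _ _ *:%R (T a) (@total_act_r a).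
pose Tw a : {linear dsum (fobj V) -> dsum (fobj V)} := HB.pack (T a) (TT a).
have bl g : total_act (basis g) (total_act b w)
          = total_act (camul (basis g) b) w.
  apply: (@freemod_ind _ _ _ (Tw (basis g) \o Lw w)
    (Lw w \o camul (basis g))) => f.
  by rewrite /= camul_basis; apply: bb.
exact: (@freemod_ind _ _ _ (Lw (total_act b w)) (Lw w \o rcamul b)) bl a.
Qed.

Definition total_module : camodule :=
  CAModule total_act_l total_act_r total_actA.

End Total.

(* The A-module Ae (x)_{eAe} eW, where A is the category algebra. *)
Section Induced.
Variables (e : catalg) (W : camodule).

Definition Ae := lin_image (rcamul e).
Definition eAe := lin_image (camul e \o rcamul e).
Definition eW := lin_image (@caact W e).

Fact Ae_rclosed (x : Ae) (b : eAe) :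
  camul (val x) (val b) \in in_image (rcamul e).
Proof.
case: (imageP x) (imageP b) => [x' <-] [b' <-]; apply/asboolP.
by exists (camul (camul x' e) (camul e b')); rewrite /= /rcamul !camulA.
Qed.

Fact eW_lclosed (b : eAe) (w : eW) :
  caact (val b) (val w) \in in_image (@caact W e).
Proof.
case: (imageP b) (imageP w) => [b' <-] [w' <-]; apply/asboolP.
by exists (caact (camul b' e) (caact e w')); rewrite /= /rcamul !caactA !camulA.
Qed.

Fact Ae_lclosed a (x : Ae) : camul a (val x) \in in_image (rcamul e).
Proof.
case: (imageP x) => [x' <-]; apply/asboolP.
by exists (camul a x'); rewrite /rcamul camulA.
Qed.

Definition Ae_ract (x : Ae) (b : eAe) : Ae := Image _ (Ae_rclosed x b).
Definition eW_lact (b : eAe) (w : eW) : eW := Image _ (eW_lclosed b w).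
Definition Ae_lact a (x : Ae) : Ae := Image _ (Ae_lclosed a x).

Definition induced_car := tensor Ae_ract eW_lact.

Definition induced_act (a : catalg) : induced_car -> induced_car :=
  tlift (fun x w => tmk Ae_ract eW_lact (Ae_lact a x) w).

Let t x w : induced_car := tmk Ae_ract eW_lact x w.
Let tb : balanced Ae_ract eW_lact t := tmk_balanced Ae_ract eW_lact.

Fact induced_balanced a :
  balanced Ae_ract eW_lact (fun x w => t (Ae_lact a x) w).
Proof.
split=> [w c x y|x c w w'|x b w].
- rewrite -(balanced_l tb) /=; congr (t _ _); apply: val_inj => /=.
  exact: linearP.
- exact: (balanced_r tb).
- rewrite -(balanced_b tb); congr (t _ _); apply: val_inj => /=.
  exact: camulA.
Qed.

Lemma induced_actE a x w : induced_act a (t x w) = t (Ae_lact a x) w.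
Proof. exact: tlift_tmk (induced_balanced a) _ _. Qed.

Fact induced_act_r a : linear (induced_act a).
Proof. exact: tlift_linear (induced_balanced a). Qed.

HB.instance Definition _ a :=
  GRing.isLinear.Build R induced_car induced_car *:%R
    (induced_act a) (@induced_act_r a).

Fact induced_act_l z : linear (induced_act^~ z).
Proof.
move=> c a b; apply: (@tensor_ind _ _ _ _ _ _ _ (induced_act (c *: a + b))
  (c \*: induced_act a \+ induced_act b)) => x w /=.
rewrite !induced_actE -(balanced_l tb) /=; congr (t _ _); apply: val_inj => /=.
exact: camul_linear_l.
Qed.

Fact induced_actA a b z :
  induced_act a (induced_act b z) = induced_act (camul a b) z.
Proof.
apply: (@tensor_ind _ _ _ _ _ _ _ (induced_act a \o induced_act b)
  (induced_act (camul a b))) => x w /=.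
rewrite !induced_actE; congr (t _ _); apply: val_inj => /=.
exact: camulA.
Qed.

Definition induced : camodule :=
  CAModule induced_act_l induced_act_r induced_actA.

End Induced.

End CategoryAlgebra.

(* e_0 + e_1 + ... + e_N *)
Definition idem (R : comPzRingType) (C : category nat) (N : nat) : catalg R C :=
  \sum_(n < N.+1) basis (Mor (idm (n : nat))).

Definition centrally_stable (R : comPzRingType) (C : category nat)
    (V : functor C (RMod R)) :=
  exists N0 : nat, forall N : nat, (N0 <= N)%N ->
    ca_isomorphic (induced (idem R C N) (total_module V)) (total_module V).

Section PutmanSam.
Variables (R : comPzRingType) (O : Type) (A : category O).
Variables (M : sym_monoidal A) (X : O).

Definition pow_le (N : nat) (U : O) :=
  exists2 n : nat, (n <= N)%N & isomorphic A U (mpow M X n).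

Definition pow_le_incl (N : nat) :
    functor (full_on A (@proj1_sig O (pow_le N))) A :=
  full_incl A (@proj1_sig O (pow_le N)).

(* The unit of the Kan extension is the identity of the restriction of V. *)
Definition ps_centrally_stable (V : functor A (RMod R)) :=
  exists N0 : nat, forall N : nat, (N0 <= N)%N ->
    @is_left_kan _ _ _ _ _ _ (pow_le_incl N)
      (functor_comp V (pow_le_incl N)) V (nattrans_id _).

End PutmanSam.

(* Main.v *)
Require Import Defs.
From HB Require Import structures.
From mathcomp Require Import all_boot all_algebra.
From mathcomp Require Import boolp classical_sets cardinality fsbigop.

(* Transporting along chosen isomorphisms U ~ X^n shows that V is the left Kan
   extension of its restriction to the objects X^n, n <= N, over A iff it is so
   over the skeleton.  Over the skeleton, let e = e_0 + ... + e_N and W be the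
   total module of V.
   If V is a Kan extension, the maps v |-> e (x) v, for v in V(n) and n <= N,
   extend to a map W -> Ae (x) eW, and this map inverts the counit.
   Conversely, any isomorphism phi : Ae (x) eW -> W, not just the counit, gives
   the extension of a natural map g from V to a module M that is defined on the
   n <= N only, as phi^-1 followed by x (x) w |-> x g(phi(e (x) w)): on
   e(Ae (x) eW) the latter is g o phi.  Extensions are unique because
   Ae (x) eW, hence W, is generated by the image of e. *)

Set Implicit Arguments.
Unset Strict Implicit.
Unset Printing Implicit Defensive.

Import GRing.Theory.
Local Open Scope ring_scope.

#[local] Obligation Tactic := idtac.

(** * Kan extensions from full subcategories *)

Lemma nattrans_ext O O' (A : category O) (B : category O') (F G : functor A B)
  (d d' : nattrans F G) : (forall U, d U = d' U) -> d = d'.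
Proof.
case: d d' => [d dN] [d' dN'] /= dd.
have {}dd := functional_extensionality_dep dd; subst d'.
by rewrite (Prop_irrelevance dN dN').
Qed.

(** For [P := pow_le M X N] this unfolds to the condition in [ps_centrally_stable]. *)
Definition kan_on O O' (A : category O) (E : category O') (P : O -> Prop)
    (V : functor A E) :=
  @is_left_kan _ _ _ _ _ _ (full_incl A (@proj1_sig O P))
    (functor_comp V (full_incl A (@proj1_sig O P))) V (nattrans_id _).

(** The unit is an identity, so it drops out of the factorization, and [exists!] splits into
    extension and uniqueness. Passing [pU] to [g] as an argument removes the objects of sigma
    type. *)
Lemma kan_onP O O' (A : category O) (E : category O') (P : O -> Prop)
    (V : functor A E) :
  kan_on P V <-> forall M : functor A E,
    (forall g : (forall U, P U -> E (V U) (M U)),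
      (forall U W (pU : P U) (pW : P W) (f : A U W),
        g W pW \om fmap V f = fmap M f \om g U pU) ->
      exists d : nattrans V M, forall U (pU : P U), d U = g U pU) /\
    (forall d d' : nattrans V M, (forall U, P U -> d U = d' U) ->
      forall U, d U = d' U).
Proof.
pose K := full_incl A (@proj1_sig O P).
split=> [kan M|ext M gamma].
- split=> [g gN|d d' dd'].
    pose gamma := @Nattrans _ _ _ _ (functor_comp V K) (functor_comp M K)
      (fun c => g _ (proj2_sig c)) (fun c c' f => gN _ _ _ _ f).
    have [d [dg _]] := kan M gamma; exists d => U pU.
    by have /= := dg (exist _ U pU); rewrite compm1 => <-.
  pose gamma := @Nattrans _ _ _ _ (functor_comp V K) (functor_comp M K)
    (fun c => d (proj1_sig c)) (fun c c' f => ntcN d f).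
  have [d0 [_ d0u]] := kan M gamma.
  suff -> : d = d' by [].
  rewrite -(d0u d) => [|c]; last by rewrite /= compm1.
  by rewrite -(d0u d') => // -[U pU]; rewrite /= compm1 dd'.
- have [ex un] := ext M.
  have [|d dg] := ex (fun U pU => gamma (exist _ U pU)).
    move=> U W pU pW f.
    exact: (ntcN gamma (U := exist _ U pU) (V := exist _ W pW) f).
  exists d; split=> [[U pU]|d' d'g]; first by rewrite /= compm1 dg.
  apply: nattrans_ext; apply: un => U pU; rewrite dg.
  by have /= := d'g (exist _ U pU); rewrite compm1.
Qed.

(** * Transport along an essentially surjective full inclusion *)

Section Skeleton.
Variables (O O' I : Type) (A : category O) (E : category O') (s : I -> O).
Variables (V : functor A E) (Q : O -> Prop).
Hypothesis s_surj : forall U, exists i, isomorphic A U (s i).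
Hypothesis Q_iso : forall U W, isomorphic A U W -> Q U -> Q W.

Section Retraction.
Variables (rep : O -> I) (r : forall U, iso A U (s (rep U))).

(** Conjugation by the chosen isomorphisms: the action on morphisms of a quasi-inverse to
    [full_incl A s]. *)
Definition retract_map U W (f : A U W) : full_on A s (rep U) (rep W) :=
  r W \om f \om bwd (r U).

Lemma retract_map1 U : retract_map (idm U) = idm (rep U).
Proof. by rewrite /retract_map compm1 bwdK. Qed.

Lemma retract_mapM U W Z (g : A W Z) (f : A U W) :
  retract_map (g \om f) = retract_map g \om retract_map f.
Proof.
suff: (retract_map (g \om f) : A _ _) =
  (retract_map g : A _ _) \om (retract_map f : A _ _) by [].
by rewrite /retract_map !compmA -(compmA (r Z \om g) (bwd (r W))) fwdK compm1.
Qed.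

Definition retraction : functor A (full_on A s) :=
  Functor retract_map1 retract_mapM.

End Retraction.

Lemma kan_on_skeleton :
  kan_on Q V <-> kan_on (fun i => Q (s i)) (functor_comp V (full_incl A s)).
Proof.
have rep_iso U : {i : I & iso A U (s i)}.
  have [i Ui] := cid (s_surj U); exists i.
  suff /cid[] : exists _ : iso A U (s i), True by [].
  by case: Ui => f; exists f.
pose rep U := projT1 (rep_iso U).
pose r U : iso A U (s (rep U)) := projT2 (rep_iso U).
have rK (F : functor A E) U : fmap F (bwd (r U)) \om fmap F (r U) = idm (F U).
  by rewrite -fmapM fwdK fmap1.
have Qrep U : Q U -> Q (s (rep U)) by apply: Q_iso; split; exact: r.
pose P := retraction r; pose VI := functor_comp V (full_incl A s).
rewrite !kan_onP; split=> ext M; split.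
- move=> g gN; have [ex _] := ext (functor_comp M P).
  pose h U (QU : Q U) : E (V U) (M (rep U)) := g _ (Qrep U QU) \om fmap V (r U).
  have [|d dh] := ex h.
    move=> U W QU QW f; rewrite /h [RHS]compmA.
    rewrite -[X in _ = X \om _](gN _ _ (Qrep U QU) (Qrep W QW)) /= /retract_map.
    by rewrite -!compmA -!fmapM -!compmA fwdK compm1.
  (* [rep (s i)] need not be [i]; the inverse of [r (s i)], read as a morphism of [full_on A s],
     carries [M (rep (s i))] back to [M i]. *)
  have dN i j (f : full_on A s i j) :
      (fmap M (bwd (r (s j))) \om d (s j)) \om fmap V f =
      fmap M f \om (fmap M (bwd (r (s i))) \om d (s i)).
    rewrite -compmA (ntcN d f) /= !compmA; congr (_ \om _).
    rewrite -!(fmapM M) /= /retract_map; congr fmap.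
    suff : (bwd (r (s j)) \om (r (s j) \om f \om bwd (r (s i))) : A _ _) =
      f \om bwd (r (s i)) by [].
    by rewrite !compmA fwdK comp1m.
  exists (@Nattrans _ _ _ _ VI M _ dN) => i Qi /=; rewrite dh /h compmA.
  rewrite -[X in X \om _ = _](gN _ _ (Qrep _ Qi) Qi) /=.
  by rewrite -compmA -fmapM /= fwdK fmap1 compm1.
- move=> d d' dd' i; have [_ un] := ext (functor_comp M P).
  (* Precomposition with [V(r U)] turns a natural map over the skeleton into one from [V] to
     [functor_comp M P], where uniqueness is available; naturality along [r (s i)] then recovers the
     original map ([dr]). *)
  have eN (d0 : nattrans VI M) U W (f : A U W) :
      (d0 (rep W) \om fmap V (r W)) \om fmap V f =
      fmap M (fmap P f) \om (d0 (rep U) \om fmap V (r U)).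
    rewrite compmA -[fmap M _ \om _](ntcN d0) /= -!compmA -!fmapM.
    by rewrite /retract_map -!compmA fwdK compm1.
  have := un (@Nattrans _ _ _ _ V (functor_comp M P) _ (eN d))
    (@Nattrans _ _ _ _ V (functor_comp M P) _ (eN d')) _ (s i); rewrite /=.
  have dr (d0 : nattrans VI M) :
      d0 i = fmap M (bwd (r (s i)) : full_on A s _ _) \om
             (d0 (rep (s i)) \om fmap V (r (s i))).
    rewrite compmA -[fmap M _ \om _](ntcN d0) /= -!compmA -!fmapM.
    by rewrite fwdK fmap1 compm1.
  by rewrite (dr d) (dr d') => -> // U /Qrep/dd' ->.
- move=> g gN; have [ex _] := ext (functor_comp M (full_incl A s)).
  have [d dg] := ex (fun i => g (s i)) (fun i j => gN (s i) (s j)).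
  (* Naturality along [r U] forces this formula for the extension. *)
  have dN U W (f : A U W) :
    (fmap M (bwd (r W)) \om d (rep W) \om fmap V (r W)) \om fmap V f =
     fmap M f \om (fmap M (bwd (r U)) \om d (rep U) \om fmap V (r U)).
    have := ntcN d (fmap P f) => /= dPf.
    rewrite -!compmA -fmapM.
    have -> : r W \om f = (retract_map r f : A _ _) \om r U.
      by rewrite /retract_map -!compmA fwdK compm1.
    rewrite fmapM (compmA (d _)) dPf !compmA -!fmapM /retract_map.
    by rewrite !compmA fwdK comp1m.
  exists (Nattrans dN) => U QU /=.
  rewrite (dg _ (Qrep U QU)) -compmA (gN _ _ QU (Qrep U QU)).
  by rewrite compmA rK comp1m.
- move=> d d' dd' U.
  pose MI := functor_comp M (full_incl A s); have [_ un] := ext MI.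
  pose res (d0 : nattrans V M) := @Nattrans _ _ _ _ VI MI (fun i => d0 (s i))
    (fun i j f => ntcN d0 (f : A (s i) (s j))).
  have dr (d0 : nattrans V M) :
      d0 U = fmap M (bwd (r U)) \om (d0 (s (rep U)) \om fmap V (r U)).
    by rewrite ntcN compmA rK comp1m.
  have := un (res d) (res d') (fun i => dd' (s i)) (rep U).
  by rewrite (dr d) (dr d') /= => ->.
Qed.

End Skeleton.

(** * Linear maps on direct sums and onto images *)

Definition linear_of (R : pzRingType) (U V : lmodType R) (f : U -> V)
    (fL : linear f) : {linear U -> V} :=
  HB.pack f (GRing.isLinear.Build R U V *:%R f fL).

Section DsumLift.
Variables (R : pzRingType) (I : choiceType) (V : I -> lmodType R).

Lemma dsum_ind (N : lmodType R) (f g : {linear dsum V -> N}) :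
  (forall i v, f (dinj (i := i) v) = g (dinj (i := i) v)) -> f =1 g.
Proof.
move=> fg x; have [s us xs] := dsum_supp x.
by rewrite (dsum_expand us xs) !linear_sum; apply: eq_bigr => i _; apply: fg.
Qed.

Variables (N : lmodType R) (h : forall i, {linear V i -> N}).

(** The map given by the universal property of the direct sum. The sum over all of [I] has finite
    support because [h i (x i)] vanishes wherever [x i] does. *)
Definition dsum_lift (x : dsum V) : N := \sum_(i \in [set: I]) h i (x i).

Lemma dsum_liftE (s : seq I) (x : dsum V) : uniq s ->
  (forall i, i \notin s -> x i = 0) -> dsum_lift x = \sum_(i <- s) h i (x i).
Proof.
move=> us xs; rewrite /dsum_lift [RHS]fsbig_seq //; symmetry.
by apply: fsbig_widen => // i [_ /= /negP/xs ->]; rewrite linear0.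
Qed.

Fact dsum_lift_linear : linear dsum_lift.
Proof.
move=> a x y; have [s us xs] := dsum_supp x; have [t ut yt] := dsum_supp y.
pose r := undup (s ++ t); have ur : uniq r by apply: undup_uniq.
have xr i : i \notin r -> x i = 0.
  by rewrite mem_undup mem_cat negb_or => /andP[/xs].
have yr i : i \notin r -> y i = 0.
  by rewrite mem_undup mem_cat negb_or => /andP[_ /yt].
rewrite !(@dsum_liftE r) //; last first.
  by move=> i ir; rewrite dsumDE dsumZE xr // yr // scaler0 addr0.
rewrite scaler_sumr -big_split; apply: eq_bigr => i _ /=.
by rewrite linearP.
Qed.

HB.instance Definition _ :=
  GRing.isLinear.Build R (dsum V) N *:%R dsum_lift dsum_lift_linear.

Lemma dsum_lift_dinj i (v : V i) : dsum_lift (dinj v) = h i v.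
Proof.
rewrite (@dsum_liftE [:: i]) ?big_seq1 ?dinj_id // => j.
by rewrite inE eq_sym => ij; rewrite dinj_neq.
Qed.

End DsumLift.

Section DProj.
Variables (R : pzRingType) (I : choiceType) (V : I -> lmodType R).

Definition dproj i (x : dsum V) : V i := x i.

Fact dproj_linear i : linear (dproj i).
Proof. by []. Qed.

HB.instance Definition _ i :=
  GRing.isLinear.Build R (dsum V) (V i) *:%R (dproj i) (@dproj_linear i).

End DProj.

Section DsumMap.
Variables (R : pzRingType) (I : choiceType) (V W : I -> lmodType R).
Variable h : forall i, {linear V i -> W i}.

Definition dsum_map : dsum V -> dsum W :=
  dsum_lift (fun i => @dinj R I W i \o h i : {linear V i -> dsum W}).

HB.instance Definition _ := GRing.Linear.on dsum_map.

Lemma dsum_map_dinj i (v : V i) : dsum_map (dinj v) = dinj (h i v).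
Proof. by rewrite /dsum_map dsum_lift_dinj. Qed.

Lemma dsum_mapE (x : dsum V) i : dsum_map x i = h i (x i).
Proof.
move: x; apply: (@dsum_ind _ _ _ _ (@dproj _ _ _ i \o dsum_map)
  (h i \o @dproj _ _ _ i)) => k v.
suff: dsum_map (dinj v) i = h i (dinj v i) by [].
rewrite dsum_map_dinj.
have [ki|ki] := eqVneq k i; first by subst k; rewrite !dinj_id.
by rewrite !dinj_neq // linear0.
Qed.

End DsumMap.

Section ToImage.
Variables (R : pzRingType) (U V : lmodType R) (f : {linear U -> V}).

Definition to_image (u : U) : lin_image f :=
  Image (f u) (asboolT (ex_intro _ u erefl)).

Fact to_image_linear : linear to_image.
Proof. by move=> a u v; apply: val_inj; rewrite /= linearP. Qed.

HB.instance Definition _ :=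
  GRing.isLinear.Build R U (lin_image f) *:%R to_image to_image_linear.

End ToImage.

(** * From modules over the category algebra to functors *)

Section Camodule.
Variables (R : comPzRingType) (O : choiceType) (C : category O).

Lemma total_act_dinj (V : functor C (RMod R)) i j (f : C i j) (v : V i) :
  total_act (basis (Mor f)) (dinj v : dsum (fobj V)) =
  dinj (fmap V f v : V j) :> dsum (fobj V).
Proof. by rewrite /total_act lext_basis dinj_id. Qed.

Section Functor.
Variable W : camodule R C.

(** The submodule [e_n W], where [e_n] is the identity of [n]; these are the values of the functor
    attached to [W]. *)
Definition part n : lmodType R :=
  lin_image (@caact _ _ _ W (basis (Mor (idm n)))).

Definition part_val n : part n -> W := @image_val _ _ _ _.

Fact part_val_linear n : linear (@part_val n).
Proof. by []. Qed.

HB.instance Definition _ n :=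
  GRing.isLinear.Build R (part n) W *:%R (@part_val n) (@part_val_linear n).

Lemma part_val_inj n : injective (@part_val n).
Proof. exact: val_inj. Qed.

Lemma part_valP n (z : part n) :
  caact (basis (Mor (idm n))) (part_val z) = part_val z.
Proof.
have [w wz] := Defs.imageP z; rewrite /part_val -[image_val z]wz.
by rewrite caactA camul_basis bmul_comp comp1m.
Qed.

Definition part_proj n : {linear W -> part n} := @to_image _ _ _ _.

Lemma part_val_proj n w :
  part_val (part_proj n w) = caact (basis (Mor (idm n))) w.
Proof. by []. Qed.

(** The action of [f] lands in [e_j W], as [e_j f = f]; [part_proj j] gives the result its type. *)
Definition part_map i j (f : C i j) : {linear part i -> part j} :=
  @part_proj j \o @caact _ _ _ W (basis (Mor f)) \o @part_val i.

Lemma part_val_map i j (f : C i j) (z : part i) :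
  part_val (part_map f z) = caact (basis (Mor f)) (part_val z).
Proof. by rewrite part_val_proj caactA camul_basis bmul_comp comp1m. Qed.

Program Definition part_functor : functor C (RMod R) :=
  @Functor _ _ C (RMod R) part part_map _ _.
Next Obligation.
move=> i; apply: linear_ext => z; apply: part_val_inj.
by rewrite part_val_map part_valP.
Qed.
Next Obligation.
move=> i j k g f; apply: linear_ext => z; apply: part_val_inj.
rewrite part_val_map -bmul_comp -camul_basis -caactA.
by rewrite -(part_val_map f) -(part_val_map g).
Qed.

End Functor.
End Camodule.

(** Evaluates products with [e]: only the identity of a single object [m] contributes, and it occurs
    in [e] exactly when [m <= N]. *)
Lemma sum_ord_one (M : nmodType) (N m : nat) (g : nat -> M) :
  (forall n, n != m -> g n = 0) ->
  \sum_(n < N.+1) g n = if (m <= N)%N then g m else 0.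
Proof.
move=> g0; rewrite -ltnS -(big_ord1_eq +%R g) [RHS]big_mkcond.
by apply: eq_bigr => n _; case: eqP => // /eqP/g0.
Qed.

(** * The idempotent [e] and the induced module *)

Section Idempotent.
Variables (R : comPzRingType) (C : category nat) (N : nat).
Local Notation e := (idem R C N).

Lemma idem_act_dinj (V : functor C (RMod R)) n (v : V n) :
  total_act e (dinj v : dsum (fobj V)) = if (n <= N)%N then dinj v else 0.
Proof.
rewrite -[LHS]/(linear_of (total_act_l (dinj v : dsum (fobj V))) e).
rewrite linear_sum /=.
rewrite (@sum_ord_one _ _ n
  (fun m => total_act (basis (Mor (idm m))) (dinj v : dsum (fobj V)))).
  by rewrite total_act_dinj fmap1.
move=> m mn; rewrite /total_act lext_basis.
by rewrite dinj_neq 1?eq_sym // !linear0.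
Qed.

Lemma camul_idem_l (f : mor C) :
  camul e (basis f) = if (tgt f <= N)%N then basis f else 0.
Proof.
rewrite -[LHS]/(rcamul (basis f) e) linear_sum /=.
rewrite (@sum_ord_one _ _ (tgt f)
  (fun m => rcamul (basis f) (basis (Mor (idm m))))).
  by case: f => i j f; rewrite /rcamul camul_basis bmul_comp comp1m.
by move=> m /eqP mf; rewrite /rcamul camul_basis bmul_neq // => /esym.
Qed.

Lemma camul_idem_r (f : mor C) :
  camul (basis f) e = if (src f <= N)%N then basis f else 0.
Proof.
rewrite linear_sum /=.
rewrite (@sum_ord_one _ _ (src f)
  (fun m => camul (basis f) (basis (Mor (idm m))))).
  by case: f => i j f; rewrite camul_basis bmul_comp compm1.
by move=> m /eqP mf; rewrite camul_basis bmul_neq.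
Qed.

Lemma idemK : camul e e = e.
Proof.
rewrite {2 3}/idem linear_sum; apply: eq_bigr => n _ /=.
by rewrite camul_idem_l /= -ltnS ltn_ord.
Qed.

Lemma Ae_idem (x : Ae e) : camul (val x) e = val x.
Proof. by have [y <-] := Defs.imageP x; rewrite /rcamul -camulA idemK. Qed.

Lemma eW_idem (W : camodule R C) (w : eW e W) : caact e (val w) = val w.
Proof. by have [y <-] := Defs.imageP w; rewrite caactA idemK. Qed.

Section Unit.
Variable W : camodule R C.

Definition ind_tmk (x : Ae e) (w : eW e W) : induced e W :=
  tmk (@Ae_ract _ _ _ e) (@eW_lact _ _ _ e W) x w.

Lemma ind_ext (P : lmodType R) (f g : {linear induced e W -> P}) :
  (forall x w, f (ind_tmk x w) = g (ind_tmk x w)) -> f =1 g.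
Proof. exact: tensor_ind. Qed.

Lemma ind_lift (P : lmodType R) (f : Ae e -> eW e W -> P) :
  balanced (@Ae_ract _ _ _ e) (@eW_lact _ _ _ e W) f ->
  exists F : {linear induced e W -> P}, forall x w, F (ind_tmk x w) = f x w.
Proof.
by move=> fb; exists (linear_of (tlift_linear fb)); exact: tlift_tmk.
Qed.

Lemma ind_act_tmk a x w : caact a (ind_tmk x w) = ind_tmk (Ae_lact a x) w.
Proof. exact: induced_actE. Qed.

(** The map [w |-> e (x) e w]; the left factor is [e] as an element of [Ae], since [e e = e]. *)
Definition ind_unit_fun (w : W) : induced e W :=
  ind_tmk (to_image (rcamul e) e) (to_image (@caact _ _ _ W e) w).

Fact ind_unit_linear : linear ind_unit_fun.
Proof.
move=> a x y; rewrite /ind_unit_fun linearP.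
exact: (balanced_r (tmk_balanced _ _)).
Qed.

Definition ind_unit : {linear W -> induced e W} := linear_of ind_unit_linear.

(** As [x = x e] and [w = e w], the image of [ind_unit] generates the induced module over the
    category algebra. *)
Lemma ind_tmkE (x : Ae e) (w : eW e W) :
  ind_tmk x w = caact (val x) (ind_unit (val w)).
Proof.
rewrite [RHS]ind_act_tmk; congr ind_tmk; apply: val_inj => /=.
  by rewrite /rcamul idemK Ae_idem.
by rewrite eW_idem.
Qed.

Lemma ind_unit_idem w : caact e (ind_unit w) = ind_unit w.
Proof.
rewrite [LHS]ind_act_tmk; congr ind_tmk; apply: val_inj => /=.
by rewrite /rcamul !idemK.
Qed.

Lemma ind_unit_caact_idem w : ind_unit (caact e w) = ind_unit w.
Proof.
congr ind_tmk; apply: val_inj => /=.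
by rewrite caactA idemK.
Qed.

(** The hypotheses put [a] in [eAe], so it can be moved across the tensor sign:
    [a e (x) e w = e a (x) e w = e (x) a e w]. *)
Lemma ind_unit_act a w : camul e a = a -> camul a e = a ->
  caact a (ind_unit w) = ind_unit (caact a w).
Proof.
move=> ea ae; pose b := to_image (camul e \o rcamul e) a.
have bE : val b = a by rewrite /= /rcamul ae ea.
have := balanced_b (tmk_balanced (@Ae_ract _ _ _ e) (@eW_lact _ _ _ e W))
  (to_image (rcamul e) e) b (to_image (@caact _ _ _ W e) w).
move=> bal; rewrite [LHS]ind_act_tmk; move: bal.
congr (ind_tmk _ _ = ind_tmk _ _); apply: val_inj; rewrite /= /rcamul ?ae ?ea.
- by rewrite idemK ea ae.
- by rewrite !caactA ae ea.
Qed.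

End Unit.
End Idempotent.

(** * Equivariant maps out of total modules *)

Section TotalMorphisms.
Variables (R : comPzRingType) (O : choiceType) (C : category O).

Lemma total_act0l (V : functor C (RMod R)) (w : dsum (fobj V)) :
  total_act 0 w = 0.
Proof. exact: linear0 (linear_of (total_act_l w)). Qed.

Lemma total_actE (V : functor C (RMod R)) i j (f : C i j) (w : dsum (fobj V)) :
  total_act (basis (Mor f)) w = dinj (fmap V f (w i) : V j) :> dsum (fobj V).
Proof. by rewrite /total_act lext_basis. Qed.

Lemma total_morph (V : functor C (RMod R)) (W : camodule R C)
    (t : {linear dsum (fobj V) -> W}) :
  (forall i j (f : C i j) (v : V i),
    t (dinj (fmap V f v : V j)) = caact (basis (Mor f)) (t (dinj v))) ->
  forall a w, t (total_act a w) = caact a (t w).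
Proof.
move=> tf a w.
apply: (@freemod_ind _ _ _ (t \o linear_of (total_act_l w))
  (linear_of (caact_l (t w)))).
move=> [i j f] /=; rewrite total_actE; move: w.
apply: (@dsum_ind _ _ _ _ (t \o @dinj _ _ _ j \o fmap V f \o @dproj _ _ _ i)
  (@caact _ _ _ W (basis (Mor f)) \o t)) => k v.
suff: t (dinj (fmap V f ((dinj v : dsum (fobj V)) i : V i) : V j)) =
  caact (basis (Mor f)) (t (dinj v)) by [].
have [ki|ki] := eqVneq k i; first by subst k; rewrite dinj_id tf.
rewrite dinj_neq // !linear0.
(* The hypothesis at the identity of [k] shows that this identity fixes [t (dinj v)]; its product
   with [f] is 0 because [k != i]. *)
have := tf k k (idm k) v; rewrite fmap1 => ->.
rewrite caactA camul_basis bmul_neq; last by apply/eqP.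
by rewrite -[LHS](linear0 (linear_of (caact_l (t (dinj v))))).
Qed.

Lemma dsum_map_morph (V W : functor C (RMod R)) (d : nattrans V W) a w :
  dsum_map (fun i => d i : {linear V i -> W i}) (total_act a w) =
  total_act a (dsum_map (fun i => d i : {linear V i -> W i}) w).
Proof.
apply: (@total_morph V (total_module W)) => i j f v /=.
rewrite !dsum_map_dinj total_act_dinj; congr dinj.
exact: (congr1 (fun h : {linear _ -> _} => h v) (ntcN d f)).
Qed.

End TotalMorphisms.

(** * Kan extension versus the induced module, for a fixed [N] *)

Section KanInduced.
Variables (R : comPzRingType) (C : category nat) (N : nat).
Variable V : functor C (RMod R).
Local Notation e := (idem R C N).
Local Notation W := (total_module V).
Local Notation T := (induced e W).
Local Notation u := (@ind_unit R C N W).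

Lemma Ae_sandwich (x : Ae e) :
  camul e (camul e (val x)) = camul e (val x) /\
  camul (camul e (val x)) e = camul e (val x).
Proof. by rewrite camulA idemK -camulA Ae_idem. Qed.

Lemma eAe_sandwich (b : eAe e) :
  camul e (val b) = val b /\ camul (val b) e = val b.
Proof.
have [y <-] := Defs.imageP b; rewrite /= /rcamul; split.
  by rewrite camulA idemK.
by rewrite -!camulA idemK.
Qed.

(** An element [a = e a e] is a combination of morphisms between objects [<= N], and for these [g]
    is natural. *)
Lemma truncated_morph (M : functor C (RMod R))
    (g : forall n, {linear V n -> M n}) :
  (forall i j (f : C i j) (v : V i), (i <= N)%N -> (j <= N)%N ->
    g j (fmap V f v) = fmap M f (g i v)) ->
  forall a w, camul e a = a -> camul a e = a ->
    dsum_map g (total_act a w) = total_act a (dsum_map g w).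
Proof.
move=> gN a w ea ae.
have -> : a = camul (camul e a) e by rewrite ea ae.
apply: (@freemod_ind _ _ _
  (dsum_map g \o linear_of (total_act_l w) \o rcamul e \o camul e)
  (linear_of (total_act_l (dsum_map g w)) \o rcamul e \o camul e)) => -[i j f].
rewrite /= /rcamul camul_idem_l /=.
case: leqP => jN; last by rewrite camul0l !total_act0l linear0.
rewrite camul_idem_r /=.
case: leqP => iN; last by rewrite !total_act0l linear0.
by rewrite !total_actE dsum_map_dinj dsum_mapE gN.
Qed.

Lemma kan_of_iso : ca_isomorphic T W -> kan_on (fun n => n <= N)%N V.
Proof.
case=> phi [[phi' phiK phi'K] phiA]; apply/kan_onP => M.
have phi'A a w : phi' (total_act a w) = caact a (phi' w).
  by apply: (can_inj phiK); rewrite phiA !phi'K.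
pose phi'L : {linear W -> T} := linear_of (can2_linear phiK phi'K).
split=> [g gN|d d' dd' n].
  (* Extending [g] by 0 above [N] gives a linear map [G] on all of [W], which commutes with the
     elements of [eAe]. *)
  have [h hg] : exists h : (forall n, RMod R (V n) (M n)),
      forall n (nN : (n <= N)%N), h n = g n nN.
    exists (fun n => match pselect (n <= N)%N with
      | left nN => g n nN | right _ => \0 : {linear V n -> M n} end) => n nN.
    by case: pselect => // nN'; rewrite (Prop_irrelevance nN nN').
  pose G : {linear dsum (fobj V) -> dsum (fobj M)} :=
    dsum_map (h : forall n, {linear V n -> M n}).
  have GA a w : camul e a = a -> camul a e = a ->
      G (total_act a w) = total_act a (G w).
    apply: truncated_morph => i j f v iN jN; rewrite !hg.
    exact: (congr1 (fun h : {linear _ -> _} => h v) (gN i j iN jN f)).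
  pose F0 (x : Ae e) (w : eW e W) : total_module M :=
    total_act (val x) (G (phi (u (val w)))).
  have F0b : balanced (@Ae_ract _ _ _ e) (@eW_lact _ _ _ e W) F0.
    split=> [w a x x'|x a w w'|x b w].
    - exact: (total_act_l _ a (val x) (val x')).
    - by rewrite /F0 !linearP total_act_r.
    (* Balancing holds because [u] and [G] commute with the elements of [eAe], and [phi] with the
       whole algebra. *)
    - have [eb be] := eAe_sandwich b.
      rewrite /F0 /= -total_actA -GA //; congr (total_act _ (G _)).
      exact: etrans (esym (phiA _ _)) (congr1 phi (ind_unit_act _ eb be)).
  have [F Ft] := ind_lift F0b.
  have FA a z : F (caact a z) = total_act a (F z).
    apply: (@ind_ext _ _ _ _ _ (F \o @caact _ _ _ T a)
      (@caact _ _ _ (total_module M) a \o F)) => x w.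
    rewrite [LHS](congr1 F (ind_act_tmk _ _ _)) [LHS]Ft.
    by rewrite [RHS](congr1 (total_act a) (Ft _ _)) /F0 total_actA.
  have Fe z : F (caact e z) = G (phi (caact e z)).
    apply: (@ind_ext _ _ _ _ _ (F \o @caact _ _ _ T e)
      (G \o phi \o @caact _ _ _ T e)) => x w.
    (* [e x] lies in [eAe], so it passes through [G], which [x] alone need not do. *)
    have [ex xe] := Ae_sandwich x.
    transitivity (total_act (camul e (val x)) (G (phi (u (val w))))).
      by rewrite [LHS](congr1 F (ind_act_tmk _ _ _)) [LHS]Ft.
    rewrite -GA //; congr (G _); apply: etrans (esym (phiA _ _)) _.
    congr (phi _); rewrite [RHS](congr1 (caact e) (ind_tmkE _ _)).
    by rewrite [RHS]caactA.
  pose d n : RMod R (V n) (M n) :=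
    @dproj _ _ _ n \o F \o phi'L \o @dinj _ _ _ n : {linear V n -> M n}.
  have dN i j (f : C i j) : d j \om fmap V f = fmap M f \om d i.
    apply: linear_ext => v /=.
    by rewrite -total_act_dinj phi'A FA /= total_actE /dproj dinj_id.
  exists (Nattrans dN) => n nN; apply: linear_ext => v /=.
  (* For [n <= N] the summand [V n] lies in [e W], so [Fe] applies and [phi] cancels against its
     inverse. *)
  have -> : dinj v = caact e (dinj v : W) :> W.
    by rewrite /= idem_act_dinj nN.
  rewrite phi'A Fe -phi'A phi'K /= idem_act_dinj nN.
  by rewrite /G dsum_map_dinj /dproj dinj_id hg.
pose D (d : nattrans V M) : {linear dsum (fobj V) -> dsum (fobj M)} :=
  dsum_map (fun n => d n : {linear V n -> M n}).
(* A generator [x (x) w] equals [x e u(w)], so [phi] sends it to [x e phi(u(w))]; [D d] and [D d']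
   are equivariant and agree on [e W]. *)
have DD z : D d (phi z) = D d' (phi z).
  apply: (@ind_ext _ _ _ _ _ (D d \o phi) (D d' \o phi)) => x w.
  rewrite ind_tmkE -ind_unit_idem /= !phiA /=.
  rewrite [LHS]dsum_map_morph [RHS]dsum_map_morph.
  congr total_act; move: (phi _).
  apply: (@dsum_ind _ _ _ _ (D d \o linear_of (total_act_r e))
    (D d' \o linear_of (total_act_r e))) => k v.
  rewrite /= idem_act_dinj; case: ifP => kN; last by rewrite !linear0.
  by rewrite /D !dsum_map_dinj dd'.
apply: linear_ext => v; rewrite -(dinj_id (d n v)) -(dinj_id (d' n v)).
have : D d (dinj v : dsum (fobj V)) = D d' (dinj v).
  by have := DD (phi' (dinj v)); rewrite phi'K.
by rewrite /D /= !dsum_map_dinj => /(congr1 (@dproj _ _ _ n)).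
Qed.

Lemma basis_idem (f : mor C) : (src f <= N)%N -> (tgt f <= N)%N ->
  camul e (basis f) = basis f /\ camul (basis f) e = basis f.
Proof. by move=> sf tf; rewrite camul_idem_l camul_idem_r sf tf. Qed.

Lemma counit_exists : exists eps : {linear T -> W},
  (forall x w, eps (ind_tmk x w) = total_act (val x) (val w)) /\
  forall a z, eps (caact a z) = total_act a (eps z).
Proof.
pose E0 (x : Ae e) (w : eW e W) : W := total_act (val x) (val w).
have E0b : balanced (@Ae_ract _ _ _ e) (@eW_lact _ _ _ e W) E0.
  split=> [w a x x'|x a w w'|x b w].
  - exact: (total_act_l _ a (val x) (val x')).
  - exact: (total_act_r _ a (val w) (val w')).
  - by rewrite /E0 /= total_actA.
have [F Ft] := ind_lift E0b; exists F; split=> // a.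
apply: (@ind_ext _ _ _ _ _ (F \o @caact _ _ _ T a)
  (@caact _ _ _ W a \o F)) => x w.
rewrite [LHS](congr1 F (ind_act_tmk _ _ _)) [LHS]Ft.
by rewrite [RHS](congr1 (total_act a) (Ft _ _)) /E0 total_actA.
Qed.

Lemma iso_of_kan : kan_on (fun n => n <= N)%N V -> ca_isomorphic T W.
Proof.
have [eps [epsE epsA]] := counit_exists.
have epsu w : eps (u w) = total_act e w.
  by rewrite [LHS](epsE _ _) [LHS]total_actA /= /rcamul !idemK.
(* The extension property is applied to the functor [n |-> e_n T] and to the maps [v |-> e_n u(v)]
   for [n <= N], which are natural by [ind_unit_act]. *)
pose M := part_functor T; move=> /kan_onP kan.
pose g n (_ : (n <= N)%N) : RMod R (V n) (M n) :=
  @part_proj _ _ _ T n \o u \o @dinj _ _ _ n : {linear V n -> part T n}.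
have [|delta deltaE] := (kan M).1 g.
  move=> i j iN jN f; apply: linear_ext => v; apply: part_val_inj.
  have [fl fr] := basis_idem (f := Mor f) iN jN.
  have uf : u (dinj (fmap V f v : V j)) = caact (basis (Mor f)) (u (dinj v)).
    by rewrite -total_act_dinj [RHS](ind_unit_act _ fl fr).
  transitivity (caact (basis (Mor f)) (part_val (g i iN v : part T i))).
    rewrite [LHS](congr1 (@caact _ _ _ T (basis (Mor (idm j)))) uf).
    rewrite [RHS]caactA camul_basis bmul_comp compm1.
    by rewrite [LHS]caactA camul_basis bmul_comp comp1m.
  by rewrite -(part_val_map f).
pose ev n : RMod R (M n) (V n) :=
  @dproj _ _ _ n \o eps \o @part_val _ _ _ T n : {linear part T n -> V n}.
have evN i j (f : C i j) : ev j \om fmap M f = fmap V f \om ev i.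
  apply: linear_ext => z.
  rewrite [LHS](congr1 (fun z => eps z j) (part_val_map f z)) epsA total_actE.
  exact: dinj_id.
(* [ev \om delta] and the identity are natural endomorphisms of [V] that agree on the objects
   [<= N], since [eps] after [u] is the action of [e]; uniqueness makes them equal. *)
have evdelta n (v : V n) : ev n (delta n v) = v.
  pose idV := nattrans_id V.
  have dN i j (f : C i j) :
      (ev j \om delta j) \om fmap V f = fmap V f \om (ev i \om delta i).
    by rewrite -compmA ntcN [LHS]compmA [X in X \om _ = _]evN -compmA.
  have := (kan V).2 (@Nattrans _ _ _ _ V V _ dN) idV _ n.
  move=> /(_ _)/(congr1 (fun h : {linear V n -> V n} => h v)); apply=> i iN.
  apply: linear_ext => {}v.
  transitivity (ev i (g i iN v)); first by rewrite /= deltaE.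
  rewrite -[LHS]/((eps (caact (basis (Mor (idm i))) (u (dinj v)))) i).
  rewrite epsA epsu total_actE fmap1 dinj_id idem_act_dinj iN.
  exact: dinj_id.
pose Delta : {linear dsum (fobj V) -> T} :=
  dsum_lift (fun n => @part_val _ _ _ T n \o
    (delta n : {linear V n -> part T n}) : {linear V n -> T}).
have Delta_dinj n (v : V n) : Delta (dinj v) = part_val (delta n v : part T n).
  exact: dsum_lift_dinj.
have DeltaA a w : Delta (total_act a w) = caact a (Delta w).
  apply: total_morph => i j f v; rewrite !Delta_dinj -(part_val_map f).
  congr part_val.
  exact: (congr1 (fun h : {linear V i -> part T j} => h v) (ntcN delta f)).
(* [Delta] agrees with [u] on [e W]; hence, for [w] in [e W], [eps] followed by [Delta] sends
   [x (x) w] to [x Delta(e w) = x u(w) = x (x) w]. *)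
have DeltaE w : Delta (total_act e w) = u w.
  rewrite -[RHS]ind_unit_caact_idem; move: w.
  apply: (@dsum_ind _ _ _ _ (Delta \o linear_of (total_act_r e))
    (u \o linear_of (total_act_r e))) => n v.
  rewrite [LHS](congr1 Delta (idem_act_dinj _ _)).
  rewrite [RHS](congr1 u (idem_act_dinj _ _)).
  case: ifP => nN; last by rewrite !linear0.
  rewrite Delta_dinj deltaE.
  have [el er] := basis_idem (f := Mor (idm n)) nN nN.
  rewrite [LHS](ind_unit_act _ el er).
  by congr (u _); rewrite [LHS]total_act_dinj fmap1.
have epsK : cancel eps Delta.
  apply: (@ind_ext _ _ _ _ _ (Delta \o eps) idfun) => x w.
  rewrite [LHS](congr1 Delta (epsE _ _)) [RHS]ind_tmkE.
  rewrite DeltaA -[X in Delta X]/(val w).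
  by rewrite -[in LHS]eW_idem DeltaE.
have DeltaK : cancel Delta eps.
  apply: (@dsum_ind _ _ _ _ (eps \o Delta) idfun) => n v.
  (* [delta n v] lies in [e_n T], so [eps] sends it into the summand at [n], where [evdelta]
     computes it. *)
  rewrite [LHS](congr1 eps (Delta_dinj _ _)) -part_valP.
  rewrite epsA total_actE fmap1.
  exact: (congr1 (@dinj _ _ _ n) (evdelta n v)).
exists eps; split; last exact: epsA.
by exists Delta.
Qed.

Lemma kan_on_induced :
  kan_on (fun n => n <= N)%N V <-> ca_isomorphic T W.
Proof. by split; [exact: iso_of_kan|exact: kan_of_iso]. Qed.

End KanInduced.

(** * Comparison of the two notions of central stability *)

Theorem corollary2p5 (R : comPzRingType) (O : Type) (A : category O)
    (M : sym_monoidal A) (HA : complemented M) (X : O) (HX : generator M X)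
    (V : functor A (RMod R)) :
  ps_centrally_stable M X V <->
  centrally_stable (functor_comp V (skeleton_incl M X)).
Proof.
(* The two conditions are equivalent for each fixed [N], so the same bound [N0] serves both. *)
suff stab N : kan_on (pow_le M X N) V <->
    ca_isomorphic (induced (idem R (skeleton M X) N)
      (total_module (functor_comp V (skeleton_incl M X))))
      (total_module (functor_comp V (skeleton_incl M X))).
  by split=> -[N0 st]; exists N0 => N /st /stab.
rewrite -kan_on_induced (@kan_on_skeleton _ _ _ _ _ (mpow M X)).
- suff -> : (fun n => pow_le M X N (mpow M X n)) = (fun n => n <= N)%N by [].
  apply/funext => n; apply/propext; split=> [[m mN nm]|nN].
    (* [X^n] is isomorphic to itself and to [X^m], so uniqueness of the exponent gives
       [n = m <= N]. *)
    have [k [_ kU]] := HX (mpow M X n).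
    suff -> : n = m by [].
    rewrite -(kU m nm); apply/esym/kU.
    by split; exists (idm _) (idm _); rewrite comp1m.
  by exists n => //; split; exists (idm _) (idm _); rewrite comp1m.
- by move=> U; have [n [Un _]] := HX U; exists n.
- move=> U U' [UU'] [n nN [Un]]; exists n => //; split.
  exists (fwd Un \om bwd UU') (fwd UU' \om bwd Un).
    by rewrite compmA -(compmA (fwd UU')) fwdK compm1 bwdK.
  by rewrite compmA -(compmA (fwd Un)) fwdK compm1 bwdK.
Qed.
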